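(* Let $G$ be a non-amenable locally compact group in which every open subgroup of infinite index is amenable. Then $G$ has Property FM.
   Context: A continuous discrete $G$-set is a discrete set $X$ with a continuous action of the topological group $G$ (equivalently, all point stabilizers are open subgroups). A mean on $X$ is a finitely additive probability measure defined on all subsets of $X$. A locally compact group $G$ has Property FM if for every continuous discrete $G$-set $X$ admitting a $G$-invariant mean on all subsets of $X$, there exists a finite $G$-orbit in $X$. Amenability of a locally compact group is meant in the usual sense for topological groups. *)

(* Defs.v *)
From HB Require Import structures.
From mathcomp Require Import all_boot all_order all_algebra.
From mathcomp Require Import all_classical all_reals all_analysis.

Set Implicit Arguments.
Unset Strict Implicit.
Unset Printing Implicit Defensive.

Import Order.TTheory GRing.Theory Num.Theory.
Import numFieldNormedType.Exports.

Local Open Scope classical_set_scope.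
Local Open Scope ring_scope.

HB.mixin Record isTopologicalGroup G of monoid.Group G & Topological G := {
  mulg_continuous : continuous (fun p : G * G => (p.1 * p.2)%g);
  invg_continuous : continuous (fun x : G => (x^-1)%g)
}.

#[short(type="topologicalGroupType")]
HB.structure Definition TopologicalGroup :=
  {G of monoid.Group G & Topological G & isTopologicalGroup G}.

Record subgroup (G : groupType) := Subgroup {
  subgroup_set :> set G;
  subgroup1 : subgroup_set 1%g;
  subgroupM : forall x y : G,
    subgroup_set x -> subgroup_set y -> subgroup_set (x * y)%g;
  subgroupV : forall x : G, subgroup_set x -> subgroup_set (x^-1)%g
}.

Section subgroup_group.
Context (G : groupType) (H : subgroup G).

Let subgroup_closed : group_closed (fun x : G => x \in (H : set G)).
Proof.
split; first by apply/mem_set; exact: subgroup1.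
move=> x y /set_mem Hx /set_mem Hy; apply/mem_set.
by apply: subgroupM => //; exact: subgroupV.
Qed.

HB.instance Definition _ := SubChoice.copy (set_type H) {x : G | x \in (H : set G)}.
HB.instance Definition _ :=
  SubChoice_isSubGroup.Build G _ (set_type H) subgroup_closed.

End subgroup_group.

(* The topology on [set_type H] is the library's: the one induced from [G]. *)
Section subgroup_topological_group.
Context (G : topologicalGroupType) (H : subgroup G).

Let set_val_continuous : continuous (set_val : set_type H -> G).
Proof. exact: initial_continuous. Qed.

Let mulg_continuous_sub :
  continuous (fun p : set_type H * set_type H => (p.1 * p.2)%g).
Proof.
apply: (@continuous_comp_initial _ _ _ (set_val : set_type H -> G)) => p.
apply: (@continuous_comp _ (G * G)%type _
  (fun q : set_type H * set_type H => (set_val q.1, set_val q.2))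
  (fun q : G * G => (q.1 * q.2)%g)); last exact: mulg_continuous.
apply: cvg_pair; apply: continuous_comp; try exact: set_val_continuous.
- exact: cvg_fst.
- exact: cvg_snd.
Qed.

Let invg_continuous_sub : continuous (fun x : set_type H => (x^-1)%g).
Proof.
apply: (@continuous_comp_initial _ _ _ (set_val : set_type H -> G)) => x.
apply: (@continuous_comp _ _ _ (set_val : set_type H -> G)
  (fun y : G => (y^-1)%g)); first exact: set_val_continuous.
exact: invg_continuous.
Qed.

HB.instance Definition _ := isTopologicalGroup.Build (set_type H)
  mulg_continuous_sub invg_continuous_sub.

End subgroup_topological_group.

Definition left_cosets (G : groupType) (H : set G) : set (set G) :=
  range (fun g : G => [set (g * h)%g | h in H]).

Definition infinite_index (G : groupType) (H : set G) : Prop :=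
  infinite_set (left_cosets H).

Section amenability.
Context (R : realType) (G : topologicalGroupType).

Definition left_translate (g : G) (f : G -> R) : G -> R :=
  fun x => f (g^-1 * x)%g.

(* The space of bounded functions whose left translates depend continuously on
   the translating element in the uniform norm. Authors call this uniformity
   "left" or "right" according to their convention. *)
Definition UCB : set (G -> R) := [set f | bounded_fun f /\
  forall e : R, 0 < e ->
    \forall u \near (1%g : G), forall x, `|left_translate u f x - f x| <= e].

(* [m] is only constrained on [UCB]; its values elsewhere are junk. *)
Record invariant_mean_UCB (m : (G -> R) -> R) : Prop := {
  mean_UCB_linear : forall (a : R) (f g : G -> R), UCB f -> UCB g ->
    m (fun x => a * f x + g x) = a * m f + m g;
  mean_UCB_ge0 : forall f : G -> R, UCB f -> (forall x, 0 <= f x) -> 0 <= m f;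
  mean_UCB1 : m (fun=> 1) = 1;
  mean_UCB_invariant : forall (g : G) (f : G -> R), UCB f ->
    m (left_translate g f) = m f
}.

Definition amenable : Prop := exists m, invariant_mean_UCB m.

End amenability.

Record is_action (G : groupType) (X : Type) (act : G -> X -> X) : Prop := {
  is_action1 : forall x, act 1%g x = x;
  is_actionM : forall (g h : G) x, act (g * h)%g x = act g (act h x)
}.

Definition continuous_action (G : topologicalGroupType) (X : topologicalType)
    (act : G -> X -> X) : Prop :=
  is_action act /\ continuous (fun p : G * X => act p.1 p.2).

Record is_mean (R : realType) (X : Type) (mu : set X -> R) : Prop := {
  mean_ge0 : forall A, 0 <= mu A;
  mean_setT : mu setT = 1;
  mean_setU : forall A B, A `&` B = set0 -> mu (A `|` B) = mu A + mu B
}.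

Definition invariant_mean (R : realType) (G : groupType) (X : Type)
    (act : G -> X -> X) (mu : set X -> R) : Prop :=
  is_mean mu /\ forall (g : G) (A : set X), mu (act g @` A) = mu A.

Definition action_orbit (G : groupType) (X : Type) (act : G -> X -> X)
    (x : X) : set X := range (fun g : G => act g x).

Definition propertyFM (R : realType) (G : topologicalGroupType) : Prop :=
  forall (X : discreteTopologicalType) (act : G -> X -> X),
    continuous_action act ->
    (exists mu : set X -> R, invariant_mean act mu) ->
    exists x : X, finite_set (action_orbit act x).

(* Main.v *)
Require Import Defs.
From mathcomp Require Import all_boot all_order all_algebra.
From mathcomp Require Import all_classical all_reals all_analysis.
From mathcomp Require Import ring lra.

Set Implicit Arguments.
Unset Strict Implicit.
Unset Printing Implicit Defensive.

Import Order.TTheory GRing.Theory Num.Theory.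
Import numFieldNormedType.Exports.

(** Suppose that a continuous discrete G-set X carries an invariant mean mu
    but has no finite orbit.  Every point stabilizer is then open, and of
    infinite index because a stabilizer of finite index gives a finite orbit;
    so every stabilizer is amenable.  It remains to see that an action with an
    invariant mean and amenable stabilizers forces G itself to be amenable,
    which contradicts the hypothesis on G.

    An invariant mean on G is obtained by averaging twice.  In each orbit fix a
    base point y and an invariant mean M_y on its stabilizer.  A uniformly
    continuous bounded f on G restricts to each coset g Stab(y), where it can
    be averaged as M_y (h |-> f (g h)).  By invariance of M_y this number
    depends only on the point g y of X (coset_mean_eq), so f yields a bounded
    function on X, linearly in f and G-equivariantly.  Integrating it against
    mu gives the desired mean (amenable_of_amenable_stabilizers).

    The second average is an integral of arbitrary bounded functions against a
    merely finitely additive mu.  It is defined as a supremum of lower sums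
    over finite partitions: common refinements make it superadditive, and
    approximation of a bounded function by a function with finitely many values
    within e makes the lower and upper integrals agree, so it is linear. *)

(** * Integration against a finitely additive mean *)

Section mean_integral.
Local Open Scope classical_set_scope.
Local Open Scope ring_scope.
Context (R : realType) (X : Type) (mu : set X -> R) (mu_mean : is_mean mu).

Lemma mean_set0 : mu set0 = 0.
Proof. by have := mean_setU mu_mean (setI0 set0); rewrite setU0; lra. Qed.

Lemma mean_fibers (T : finType) (p : X -> T) (A : set X) :
  mu A = \sum_(i : T) mu (A `&` p @^-1` [set i]).
Proof.
have fibers_in (s : seq T) : uniq s ->
    \sum_(i <- s) mu (A `&` p @^-1` [set i]) = mu (A `&` [set x | p x \in s]).
  elim: s => [|i s IHs] /=.
    rewrite big_nil -[LHS]mean_set0 => _; congr mu.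
    by apply/seteqP; split => // x [].
  move=> /andP[si us]; rewrite big_cons IHs // -(mean_setU mu_mean).
    congr mu; apply/seteqP; split => x /=.
      by move=> [[Ax ->]|[Ax px]]; rewrite inE ?eqxx ?px ?orbT.
    by rewrite inE => -[Ax /orP[/eqP pxi|px]]; [left|right].
  apply/seteqP; split => // x /= [[_ pxi] [_]].
  by rewrite pxi (negbTE si).
rewrite fibers_in ?index_enum_uniq //; congr mu; apply/seteqP.
by split => x /= => [Ax|[]]; rewrite ?mem_index_enum.
Qed.

(** The partition of X is presented as the fibres of a map p to a finite type,
    empty fibres being allowed: the common refinement of p and q is then just
    the map (p, q) to a product type. *)
Definition step_integral (T : finType) (p : X -> T) (c : T -> R) : R :=
  \sum_(i : T) c i * mu (p @^-1` [set i]).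

(** Invariance under refinement: each fibre of f \o q is the disjoint union of
    fibres of q, on which c \o f is constant. *)
Lemma step_integral_comp (S T : finType) (q : X -> S) (f : S -> T)
    (c : T -> R) :
  step_integral (f \o q) c = step_integral q (c \o f).
Proof.
rewrite /step_integral [RHS](partition_big f predT) //=.
apply: eq_bigr => i _; rewrite (mean_fibers q) mulr_sumr [RHS]big_mkcond /=.
apply: eq_bigr => j _; have [fji|fji] := eqVneq (f j) i.
  by subst i; congr (_ * mu _); apply/seteqP; split => x /= => [[]|->].
rewrite (_ : _ `&` _ = set0) ?mean_set0 ?mulr0 //.
by apply/seteqP; split => // x /= [fqi qxj]; rewrite -fqi -qxj eqxx in fji.
Qed.

Lemma step_integral_cst (T : finType) (p : X -> T) (a : R) :
  step_integral p (fun=> a) = a.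
Proof.
rewrite /step_integral -mulr_sumr -[X in _ = X]mulr1 -(mean_setT mu_mean).
by rewrite (mean_fibers p); under [in RHS]eq_bigr do rewrite setTI.
Qed.

Lemma step_integralD (T : finType) (p : X -> T) (c d : T -> R) :
  step_integral p (fun i => c i + d i) = step_integral p c + step_integral p d.
Proof.
by rewrite /step_integral -big_split /=; apply: eq_bigr => i _; rewrite mulrDl.
Qed.

(** The fibres over values that p does not take are empty, hence null. *)
Lemma step_integral_le (T : finType) (p : X -> T) (c d : T -> R) :
  (forall x, c (p x) <= d (p x)) -> step_integral p c <= step_integral p d.
Proof.
move=> cd; apply: ler_sum => i _.
have [[x /= <-]|/set0P/negP/negPn/eqP->] := pselect (p @^-1` [set i] !=set0).
  by apply: ler_wpM2r => //; exact: mean_ge0.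
by rewrite mean_set0 !mulr0.
Qed.

Definition lower_sums (F : X -> R) : set R :=
  [set r | exists (T : finType) (p : X -> T) (c : T -> R),
    (forall x, c (p x) <= F x) /\ r = step_integral p c].

Definition mean_integral (F : X -> R) : R := sup (lower_sums F).

Definition bounded_real (F : X -> R) : Prop :=
  exists M, forall x, `|F x| <= M.

Lemma bounded_realN F : bounded_real F -> bounded_real (fun x => - F x).
Proof. by move=> [M FM]; exists M => x; rewrite normrN. Qed.

Lemma bounded_realD F G : bounded_real F -> bounded_real G ->
  bounded_real (fun x => F x + G x).
Proof.
move=> [M FM] [N GN]; exists (M + N) => x.
by apply: (le_trans (ler_normD _ _)); exact: lerD.
Qed.

Lemma bounded_realM (a : R) F : bounded_real F ->
  bounded_real (fun x => a * F x).
Proof.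
move=> [M FM]; exists (`|a| * M) => x.
by rewrite normrM; exact: ler_wpM2l.
Qed.

Lemma lower_sums_ubound (F : X -> R) (M : R) :
  (forall x, F x <= M) -> ubound (lower_sums F) M.
Proof.
move=> FM _ [T [p [c [cF ->]]]]; rewrite -(step_integral_cst p M).
by apply: step_integral_le => x; exact: le_trans (FM x).
Qed.

Lemma lower_sums_cst (F : X -> R) (M : R) :
  (forall x, M <= F x) -> lower_sums F M.
Proof.
move=> MF; exists unit, (fun=> tt), (fun=> M); split => //.
by rewrite step_integral_cst.
Qed.

Lemma has_sup_lower_sums F : bounded_real F -> has_sup (lower_sums F).
Proof.
move=> [M FM]; split.
  by exists (- M); apply: lower_sums_cst => x; have := FM x; rewrite ler_norml => /andP[].
by exists M; apply: lower_sums_ubound => x; have := FM x; rewrite ler_norml => /andP[].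
Qed.

(** Both step functions live on the common refinement of their partitions,
    where their sum is again a step function. *)
Lemma lower_sumsD F G r s : lower_sums F r -> lower_sums G s ->
  lower_sums (fun x => F x + G x) (r + s).
Proof.
move=> [S [p [c [cF ->]]]] [T [q [d [dG ->]]]].
pose pq x := (p x, q x).
exists (S * T)%type, pq, (fun k => c k.1 + d k.2); split.
  by move=> x; apply: lerD; [exact: cF | exact: dG].
rewrite step_integralD; congr (_ + _).
- exact: (@step_integral_comp (S * T)%type _ pq fst).
- exact: (@step_integral_comp (S * T)%type _ pq snd).
Qed.

Lemma lower_sumsM (a : R) F r : 0 <= a -> lower_sums F r ->
  lower_sums (fun x => a * F x) (a * r).
Proof.
move=> a0 [T [p [c [cF ->]]]]; exists T, p, (fun i => a * c i); split.
  by move=> x; exact: ler_wpM2l.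
by rewrite /step_integral mulr_sumr; apply: eq_bigr => i _; rewrite mulrA.
Qed.

(** Upper and lower sums get arbitrarily close: rounding F down to a multiple of
    e gives a step function below F which, raised by e, is above F. *)
Lemma lower_sums_approx F (e : R) : bounded_real F -> 0 < e ->
  exists2 r, lower_sums F r & lower_sums (fun x => - F x) (- (r + e)).
Proof.
move=> [M FM] e0.
have FM0 x : 0 <= F x + M by have := FM x; rewrite ler_norml => /andP[]; lra.
(* Adding M makes the function nonnegative, with values in [0, 2M]. *)
pose level x := Num.truncn ((F x + M) / e).
have levelP x : (level x)%:R * e <= F x + M < (level x)%:R * e + e.
  have /andP[] := truncn_itv (divr_ge0 (FM0 x) (ltW e0)).
  rewrite ler_pdivlMr // ltr_pdivrMr // => -> /=.
  by rewrite -natr1 mulrDl mul1r.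
pose N := Num.truncn ((M + M) / e).
have levelN x : (level x < N.+1)%N.
  rewrite ltnS; apply: le_truncn; rewrite ler_pM2r ?invr_gt0 //.
  by have := FM x; rewrite ler_norml => /andP[]; lra.
pose p x := Ordinal (levelN x).
pose c (i : 'I_N.+1) : R := (i : nat)%:R * e - M.
exists (step_integral p c).
  by exists 'I_N.+1, p, c; split => // x; rewrite /c /=; have /andP[] := levelP x; lra.
exists 'I_N.+1, p, (fun i => -1 * c i + - e); split.
  by move=> x; rewrite /c /=; have /andP[] := levelP x; lra.
rewrite [RHS]step_integralD step_integral_cst opprD; congr (_ + _).
rewrite /step_integral -sumrN; apply: eq_bigr => i _.
by rewrite mulN1r mulNr.
Qed.

Lemma mean_integral_cst (a : R) : mean_integral (fun=> a) = a.
Proof.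
apply/le_anti/andP; split.
  apply: ge_sup; first by exists a; exact: lower_sums_cst.
  exact: lower_sums_ubound.
apply: ub_le_sup; last exact: lower_sums_cst.
by exists a; exact: lower_sums_ubound.
Qed.

Lemma mean_integral_ge0 F : bounded_real F -> (forall x, 0 <= F x) ->
  0 <= mean_integral F.
Proof.
move=> bF F0; apply: ub_le_sup; first by case: (has_sup_lower_sums bF).
exact: lower_sums_cst.
Qed.

Lemma mean_integral_superadditive F G : bounded_real F -> bounded_real G ->
  mean_integral F + mean_integral G <= mean_integral (fun x => F x + G x).
Proof.
move=> bF bG; have sF := has_sup_lower_sums bF; have sG := has_sup_lower_sums bG.
rewrite -sup_sumE //; apply: ge_sup.
  by case: sF => -[r Fr] _; case: sG => -[s Gs] _; exists (r + s), r => //; exists s.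
move=> _ [r Fr [s Gs <-]]; apply: ub_le_sup; last exact: lower_sumsD.
by case: (has_sup_lower_sums (bounded_realD bF bG)).
Qed.

(** One inequality is superadditivity applied to F + (- F) = 0; the other says
    that the upper integral does not exceed the lower one. *)
Lemma mean_integralN F : bounded_real F ->
  mean_integral (fun x => - F x) = - mean_integral F.
Proof.
move=> bF; have bNF := bounded_realN bF.
apply/le_anti/andP; split.
  have := mean_integral_superadditive bF bNF.
  by under [X in _ <= mean_integral X]funext do rewrite subrr;
    rewrite mean_integral_cst; lra.
rewrite lerNl; apply/ler_addgt0Pr => e e0.
have [r Fr NFr] := lower_sums_approx bF e0.
have rF : r <= mean_integral F.
  by apply: ub_le_sup => //; case: (has_sup_lower_sums bF).
have rNF : - (r + e) <= mean_integral (fun x => - F x).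
  by apply: ub_le_sup => //; case: (has_sup_lower_sums bNF).
lra.
Qed.

Lemma mean_integralD F G : bounded_real F -> bounded_real G ->
  mean_integral (fun x => F x + G x) = mean_integral F + mean_integral G.
Proof.
move=> bF bG; apply/le_anti/andP; split; last exact: mean_integral_superadditive.
(* Subadditivity is superadditivity for F = (F + G) + (- G). *)
have := mean_integral_superadditive (bounded_realD bF bG) (bounded_realN bG).
rewrite mean_integralN //.
by under [X in _ <= mean_integral X]funext do rewrite addrK; lra.
Qed.

Lemma mean_integralM (a : R) F : bounded_real F ->
  mean_integral (fun x => a * F x) = a * mean_integral F.
Proof.
have pos_le (b : R) H : bounded_real H -> 0 < b ->
    b * mean_integral H <= mean_integral (fun x => b * H x).
  move=> bH b0; rewrite mulrC -ler_pdivlMr //.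
  apply: ge_sup; first by case: (has_sup_lower_sums bH).
  move=> r Hr; rewrite ler_pdivlMr // mulrC; apply: ub_le_sup.
    by case: (has_sup_lower_sums (bounded_realM b bH)).
  by apply: lower_sumsM => //; exact: ltW.
(* The converse inequality is the same one for the factor 1 / b. *)
have pos (b : R) H : bounded_real H -> 0 < b ->
    mean_integral (fun x => b * H x) = b * mean_integral H.
  move=> bH b0; apply/le_anti/andP; split; last exact: pos_le.
  have bV0 : 0 < b^-1 by rewrite invr_gt0.
  have := pos_le b^-1 _ (bounded_realM b bH) bV0.
  under [X in _ <= mean_integral X]funext do rewrite mulKf ?gt_eqF //.
  by rewrite mulrC ler_pdivrMr // mulrC.
move=> bF; have [a0|a0|->] := ltgtP a 0; last 1 first.
- rewrite mul0r -[RHS](mean_integral_cst 0); congr mean_integral.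
  by apply/funext => x; rewrite mul0r.
- have Na0 : 0 < - a by rewrite oppr_gt0.
  rewrite -[RHS]opprK -mulNr -pos // -mean_integralN; last exact: bounded_realM.
  by congr mean_integral; apply/funext => x; rewrite mulNr opprK.
- exact: pos.
Qed.

Lemma mean_integral_invariant (f g : X -> X) F : cancel f g -> cancel g f ->
  (forall A, mu (f @` A) = mu A) ->
  mean_integral (F \o f) = mean_integral F.
Proof.
move=> fK gK muf.
have imgE (B : set X) : f @` B = g @^-1` B.
  apply/seteqP; split => [_ [y By <-]|x Bgx] /=; first by rewrite fK.
  by exists (g x); rewrite ?gK.
have muV (B : set X) : mu (f @^-1` B) = mu B.
  rewrite -muf; congr mu; apply/seteqP; split => [_ [y fBy <-] //|x Bx].
  by exists (g x); rewrite /= gK.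
have muVg (B : set X) : mu (g @^-1` B) = mu B by rewrite -imgE muf.
rewrite /mean_integral; congr sup; apply/seteqP; split => r.
- move=> [T [p [c [cF ->]]]]; exists T, (p \o g), c; split.
    by move=> x; have := cF (g x); rewrite /= gK.
  by apply: eq_bigr => i _; rewrite -muVg.
- move=> [T [p [c [cF ->]]]]; exists T, (p \o f), c; split.
    by move=> x; exact: cF.
  by apply: eq_bigr => i _; rewrite -muV.
Qed.

End mean_integral.

(** * Uniformly continuous bounded functions and their restriction to cosets *)

Section uniformly_continuous_bounded.
Local Open Scope classical_set_scope.
Local Open Scope ring_scope.
Context (R : realType).

Lemma bounded_funE (T : Type) (f : T -> R) : bounded_fun f <-> bounded_real f.
Proof.
split=> [[M [_ fM]]|[M fM]].
  exists (M + 1) => x; apply: (fM (M + 1)) => //; first by rewrite ltrDl.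
exists M; split; first exact: num_real.
by move=> N MN x _; apply: le_trans (ltW MN).
Qed.

Context (G : topologicalGroupType).

Lemma UCB_cst (a : R) : UCB ((fun=> a) : G -> R).
Proof.
split; first by apply/bounded_funE; exists `|a|.
by move=> e e0; near=> u => x; rewrite /left_translate subrr normr0 ltW.
Unshelve. all: by end_near. Qed.

(** The modulus is split as e/2 + e/2; the divisor |a| + 1 avoids a case
    distinction on a = 0. *)
Lemma UCB_linear (a : R) (f g : G -> R) : UCB f -> UCB g ->
  UCB (fun x => a * f x + g x).
Proof.
move=> [/bounded_funE bf cf] [/bounded_funE bg cg]; split.
  by apply/bounded_funE; apply: bounded_realD => //; exact: bounded_realM.
move=> e e0; pose b := `|a| + 1.
have b0 : 0 < b by rewrite /b ltr_wpDl.
have eb0 : 0 < e / 2 / b by rewrite !divr_gt0.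
have e20 : 0 < e / 2 by rewrite divr_gt0.
near=> u => x; rewrite /left_translate.
set f' := f _; set g' := g _.
have -> : a * f' + g' - (a * f x + g x) = a * (f' - f x) + (g' - g x) by ring.
apply: (le_trans (ler_normD _ _)); rewrite [X in _ <= X](splitr e) normrM.
apply: lerD; last by move: x @f' @g'; near: u; exact: cg.
have fe : `|f' - f x| <= e / 2 / b by move: x @f' @g'; near: u; exact: cf.
apply: (le_trans (ler_wpM2l (normr_ge0 a) fe)).
rewrite mulrCA -[leRHS]mulr1 ler_wpM2l ?(ltW e20) //.
by rewrite ler_pdivrMr // mul1r /b lerDl.
Unshelve. all: by end_near. Qed.

(** Positivity applied to M + f and M - f; it gives the same bound for all the
    coset averages of f, whichever means are chosen on the stabilizers. *)
Lemma invariant_mean_bound (m : (G -> R) -> R) (f : G -> R) (M : R) :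
  invariant_mean_UCB m -> UCB f -> (forall x, `|f x| <= M) -> `|m f| <= M.
Proof.
move=> mm fU fM.
have m_cst a : m (fun=> a) = a.
  have -> : (fun=> a) = (fun x : G => (a - 1) * (fun=> 1) x + (fun=> 1) x) :> (G -> R).
    by apply/funext => x /=; ring.
  by rewrite (mean_UCB_linear mm) ?(mean_UCB1 mm) //; [ring|exact: UCB_cst..].
have shift a : m (fun x => a * f x + (fun=> M) x) = a * m f + M.
  by rewrite (mean_UCB_linear mm) ?m_cst //; exact: UCB_cst.
have ge0 a : (forall x, 0 <= a * f x + M) -> 0 <= a * m f + M.
  move=> afM; rewrite -shift; apply: (mean_UCB_ge0 mm) => //.
  by apply: UCB_linear => //; exact: UCB_cst.
have := ge0 1; have := ge0 (-1); rewrite ler_norml => m1 m2.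
have {}m1 : 0 <= -1 * m f + M.
  by apply: m1 => x; have := fM x; rewrite ler_norml => /andP[]; lra.
have {}m2 : 0 <= 1 * m f + M.
  by apply: m2 => x; have := fM x; rewrite ler_norml => /andP[]; lra.
by apply/andP; split; lra.
Qed.

Lemma set_val1 (H : subgroup G) : set_val (1%g : set_type H) = 1%g.
Proof. exact: (val1 (set_type H)). Qed.

Lemma set_valM (H : subgroup G) (h k : set_type H) :
  set_val (h * k)%g = (set_val h * set_val k)%g.
Proof. exact: (@valM _ _ (set_type H)). Qed.

Lemma set_valV (H : subgroup G) (h : set_type H) :
  set_val (h^-1)%g = ((set_val h)^-1)%g.
Proof. exact: (gmulfV (\val : set_type H -> G)). Qed.

Lemma conjg_cvg1 (g : G) : (g * u * g^-1)%g @[u --> (1%g : G)] --> (1%g : G).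
Proof.
rewrite -[X in _ --> X](mulgV g) -[X in (X * _)%g](mulg1 g).
apply: (@continuous2_cvg _ _ _ _ _ _ (fun u : G => (g * u)%g)
  (fun=> g^-1%g) (fun x y : G => (x * y)%g)); last exact: cvg_cst.
  exact: (mulg_continuous ((g * 1)%g, g^-1%g)).
apply: (@continuous2_cvg _ _ _ _ _ _ (fun=> g) id (fun x y : G => (x * y)%g)).
- exact: (mulg_continuous (g, 1%g)).
- exact: cvg_cst.
- exact: cvg_id.
Qed.

(** Translating h by u moves g h by the conjugate of u by g, and conjugates of
    elements near 1 by a fixed g are near 1. *)
Lemma UCB_coset_restrict (H : subgroup G) (g : G) (f : G -> R) : UCB f ->
  UCB (fun h : set_type H => f (g * set_val h)%g).
Proof.
move=> [/bounded_funE [M fM] cf]; split; first by apply/bounded_funE; exists M.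
move=> e /cf fe.
have near_val : \forall u \near (1%g : set_type H), forall x,
    `|left_translate (g * set_val u * g^-1)%g f x - f x| <= e.
  have := conjg_cvg1 g fe; rewrite -(set_val1 H).
  exact: (@initial_continuous _ _ (set_val : set_type H -> G) (1%g : set_type H)).
apply: filterS near_val => u /= ue h.
have := ue (g * set_val h)%g; congr (`|f _ - _| <= e).
rewrite set_valM set_valV.
by rewrite !invgM invgK !mulgA mulgVK.
Qed.

End uniformly_continuous_bounded.

(** * Stabilizers and orbits *)

Section stabilizers.
Local Open Scope classical_set_scope.
Local Open Scope ring_scope.
Context (G : topologicalGroupType).

Section abstract_action.
Context (X : Type) (act : G -> X -> X) (actP : is_action act).

Lemma actK g : cancel (act g) (act g^-1%g).
Proof. by move=> x; rewrite -(is_actionM actP) mulVg (is_action1 actP). Qed.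

Lemma actKV g : cancel (act g^-1%g) (act g).
Proof. by move=> x; rewrite -(is_actionM actP) mulgV (is_action1 actP). Qed.

Definition stabilizer (x : X) : subgroup G.
Proof.
apply: (@Subgroup G [set g | act g x = x]).
- exact: (is_action1 actP).
- by move=> g h /= gx hx; rewrite (is_actionM actP) hx.
- by move=> g /= gx; rewrite -{1}gx actK.
Defined.

(** The orbit is an image of the coset space: g x depends only on the coset of
    g modulo the stabilizer of x. *)
Lemma finite_index_stabilizer_orbit (x : X) :
  finite_set (left_cosets (stabilizer x)) -> finite_set (action_orbit act x).
Proof.
pose move_by (C : set G) := act (xget 1%g C) x.
move/(finite_image move_by); apply: sub_finite_set => _ [g _ <-].
exists [set (g * h)%g | h in stabilizer x]; first by exists g.
(* The representative picked in the coset of g is g h for some h fixing x. *)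
rewrite /move_by; case: xgetP => [_ -> [h /= hx <-]|/(_ g) []].
  by rewrite (is_actionM actP) hx.
by exists 1%g; [exact: subgroup1 | rewrite mulg1].
Qed.

(** The base point is chosen as a function of the orbit alone, so that it is
    literally constant along orbits; the point x0 is a default value for the
    choice on the empty set. *)
Lemma orbit_representatives (x0 : X) :
  exists (rep : X -> X) (t : X -> G),
    (forall x, act (t x) (rep x) = x) /\ (forall g x, rep (act g x) = rep x).
Proof.
have [sel selP] : {sel : set X -> X & forall A, A !=set0 -> A (sel A)}.
  apply: (@choice _ _ (fun A y => A !=set0 -> A y)) => A.
  have [[y Ay]|A0] := pselect (A !=set0); first by exists y.
  by exists x0 => /A0.
pose rep x := sel (action_orbit act x).
have /choice[t tP] : forall x, exists g, act g (rep x) = x.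
  move=> x; have [g _ gx] : action_orbit act x (rep x).
    by apply: selP; exists x, 1%g => //; rewrite (is_action1 actP).
  by exists g^-1%g; rewrite -gx actK.
exists rep, t; split=> // g x; congr sel; apply/seteqP; split => _ [h _ <-].
  by exists (h * g)%g => //; rewrite (is_actionM actP).
by exists (h * g^-1)%g => //; rewrite (is_actionM actP) actK.
Qed.

End abstract_action.

(** The stabilizer of x is the preimage of the open set {x} under the orbit
    map g |-> g x. *)
Lemma open_stabilizer (X : discreteTopologicalType) (act : G -> X -> X)
    (actP : is_action act) (x : X) :
  continuous (fun p : G * X => act p.1 p.2) ->
  open (stabilizer actP x : set G).
Proof.
move=> act_cont.
have : continuous (fun g : G => act g x).
  move=> g; apply: (@continuous2_cvg _ _ _ _ _ _ id (fun=> x) act).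
  - exact: (act_cont (g, x)).
  - exact: cvg_id.
  - exact: cvg_cst.
by move=> /continuousP/(_ [set x]); apply; exact: discrete_open.
Qed.

End stabilizers.

(** * Amenability from amenable stabilizers *)

Section amenability_from_stabilizers.
Local Open Scope classical_set_scope.
Local Open Scope ring_scope.
Context (R : realType) (G : topologicalGroupType).
Context (X : Type) (act : G -> X -> X) (actP : is_action act).
Notation stab := (stabilizer actP).
Context (M : forall x : X, (set_type (stab x) -> R) -> R).
Context (M_mean : forall x, invariant_mean_UCB (@M x)).

Definition coset_mean (f : G -> R) (x : X) (g : G) : R :=
  M (fun h : set_type (stab x) => f (g * set_val h)%g).

(** If g x = g' x then k = g'^-1 g fixes x, and the two functions averaged on
    the stabilizer are translates of one another by k. *)
Lemma coset_mean_eq (f : G -> R) (x : X) (g g' : G) :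
  UCB f -> act g x = act g' x -> coset_mean f x g = coset_mean f x g'.
Proof.
move=> fU gg'.
have stab_k : (g'^-1 * g)%g \in (stab x : set G).
  by apply/mem_set; rewrite /= (is_actionM actP) gg' actK.
pose k : set_type (stab x) := SigSub stab_k.
have fxU := @UCB_coset_restrict R G (stab x) g f fU.
rewrite /coset_mean -(mean_UCB_invariant (M_mean x) k fxU).
congr (M _); apply/funext => h; rewrite /left_translate set_valM set_valV.
have -> : set_val k = (g'^-1 * g)%g by [].
by rewrite invgM invgK !mulgA mulgV mul1g.
Qed.

(** The function avg f on X is the equivariant family of coset averages of f;
    its mu-integral is an invariant mean of f. *)
Lemma amenable_of_amenable_stabilizers (mu : set X -> R) :
  invariant_mean act mu -> amenable R G.
Proof.
move=> [mu_mean mu_inv].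
have [x0] : exists x : X, True.
  apply: contrapT => X0; have := mean_setT mu_mean.
  rewrite (_ : setT = set0) ?(mean_set0 mu_mean).
    by move/eqP; rewrite eq_sym oner_eq0.
  by apply/seteqP; split=> // x _; apply: X0; exists x.
move=> _; have [rep [t [tP rep_inv]]] := orbit_representatives actP x0.
pose avg (f : G -> R) (x : X) := coset_mean f (rep x) (t x).
have avg_bounded f : UCB f -> bounded_real (avg f).
  move=> fU; have [/bounded_funE [B fB] _] := fU; exists B => x.
  by apply: invariant_mean_bound (M_mean _) _ _ => //; exact: UCB_coset_restrict.
have avg_linear a f g : UCB f -> UCB g ->
    avg (fun x => a * f x + g x) = (fun x => a * avg f x + avg g x).
  move=> fU gU; apply/funext => x; rewrite /avg /coset_mean.
  by rewrite -(mean_UCB_linear (M_mean _)) //; exact: UCB_coset_restrict.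
have avg_translate s f : UCB f -> avg (left_translate s f) = avg f \o act s^-1%g.
  move=> fU; apply/funext => x; rewrite /= /avg rep_inv.
  transitivity (coset_mean f (rep x) (s^-1 * t x)%g).
    by congr (M _); apply/funext => h; rewrite /left_translate mulgA.
  (* Both elements carry the base point of the orbit of x to s^-1 x. *)
  apply: coset_mean_eq => //.
  by rewrite (is_actionM actP) tP -(rep_inv s^-1%g x) tP.
exists (fun f => mean_integral mu (avg f)); split.
- move=> a f g fU gU; rewrite avg_linear // mean_integralD //.
  + by rewrite mean_integralM //; exact: avg_bounded.
  + by apply: bounded_realM; exact: avg_bounded.
  + exact: avg_bounded.
- move=> f fU f0; apply: mean_integral_ge0 => //; first exact: avg_bounded.
  move=> x; apply: (mean_UCB_ge0 (M_mean _)) => //; exact: UCB_coset_restrict.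
- rewrite (_ : avg _ = fun=> 1) ?(mean_integral_cst mu_mean) //.
  by apply/funext => x; exact: (mean_UCB1 (M_mean _)).
- move=> s f fU; rewrite avg_translate //.
  apply: (@mean_integral_invariant _ _ _ _ (act s)).
  + exact: actKV.
  + exact: actK.
  + exact: mu_inv.
Qed.

End amenability_from_stabilizers.

Theorem proposition1p6 (R : realType) (G : topologicalGroupType)
    (G_locally_compact : locally_compact [set: G]%classic)
    (G_nonamenable : ~ amenable R G)
    (open_subgroups : forall H : subgroup G, open (H : set G) ->
       infinite_index (H : set G) -> amenable R (set_type H)) :
  propertyFM R G.
Proof.
move=> X act [actP act_cont] [mu mu_inv].
apply: contrapT => no_finite_orbit; apply: G_nonamenable.
have stab_amenable x : amenable R (set_type (stabilizer actP x)).
  apply: open_subgroups; first exact: open_stabilizer.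
  move=> fin; apply: no_finite_orbit; exists x.
  exact: finite_index_stabilizer_orbit fin.
exact: (amenable_of_amenable_stabilizers
  (fun x => projT2 (cid (stab_amenable x))) mu_inv).
Qed.
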